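(* Let $\kappa\ge 0$ and $\tau>0$. Let $(Q_h^n,s^n)_{n\ge 0}\subset \mathbf S_h^{(3)}\times\mathbb R$ be generated by the second-order sESAV2 scheme with time step $\tau$, starting from $Q_h^0\in\mathbf S_h^{(3)}$ and $s^0=\mathcal E_{1h}[Q_h^0]$. Then the scheme is unconditionally energy dissipative in the sense that $$E_h[Q_h^{n+1},s^{n+1}]\le E_h[Q_h^n,s^n],\qquad n\ge 0 .$$
   Context: Parameters: $a\in\mathbb R$, $b\ge0$, $c>0$, $L_1,L_2,L_3>0$. Domain $\Omega=[0,L_d]^3$ with $L_d>0$, mesh size $h=L_d/M$ with $M$ a positive integer. Grid functions. $\mathbf E_h^0$ is the set of real functions $U=(U_{p,q,r})_{0\le p,q,r\le M}$ that vanish when any index equals $0$ or $M$ (homogeneous Dirichlet condition). They are extended by zero to ghost nodes with index $-1$ or $M+1$. $\mathbf S_h^{(3)}$ is the set of symmetric, trace-free $3\times3$ arrays $\Phi_h=(\Phi_h^{ij})$ with $\Phi_h^{ij}\in\mathbf E_h^0$ (i.e. $\Phi_h^{ij}=\Phi_h^{ji}$, $\sum_i\Phi_h^{ii}=0$). Difference operators. $D_k^+$ is the forward difference in direction $k$ (e.g. $(D_1^+U)_{p+1/2,q,r}=(U_{p+1,q,r}-U_{p,q,r})/h$), and $D_k^c$ is the centered difference in direction $k$ (e.g. $(D_1^cU)_{p,q,r}=(U_{p+1,q,r}-U_{p-1,q,r})/(2h)$), and $D_{kl}^c=D_k^cD_l^c$. $\Delta_h$ is the standard seven-point discrete Laplacian.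 Inner products and norms. $\langle U,V\rangle_h=h^3\sum_{p,q,r=0}^{M}U_{p,q,r}V_{p,q,r}$ and $\|U\|_h^2=\langle U,U\rangle_h$. $\|\nabla_hU\|_h^2=\sum_{k=1}^3\|D_k^+U\|^2$, where $\|D_k^+U\|^2$ is $h^3$ times the sum of squares of $D_k^+U$ over all edges of the grid in direction $k$. For $\Phi_h\in\mathbf S_h^{(3)}$: $\|\Phi_h\|_h^2=\sum_{i,j}\|\Phi_h^{ij}\|_h^2$ and $\|\nabla_h\Phi_h\|_h^2=\sum_{i,j}\|\nabla_h\Phi_h^{ij}\|_h^2$. Nonlinearity (evaluated at each grid point): $f(Q^{ij})=-aQ^{ij}+b\big((Q^2)^{ij}-\tfrac13\operatorname{tr}(Q^2)\delta^{ij}\big)-c\operatorname{tr}(Q^2)Q^{ij}$. Energies. With $\mathcal F_{\rm bulk}(Q)=\frac a2\operatorname{tr}(Q^2)-\frac b3\operatorname{tr}(Q^3)+\frac c4\operatorname{tr}^2(Q^2)$, set $\mathcal E_{1h}[Q_h]=\langle\mathcal F_{\rm bulk}(Q_h),1\rangle_h$ and $$E_{el}[Q_h]=\tfrac{L_1}{2}\|\nabla_hQ_h\|_h^2+\tfrac{L_2+L_3}{2}\sum_{i=1}^3\Big\|\sum_{k=1}^3D_k^cQ_h^{ik}\Big\|_h^2,\qquad E_h[Q_h,s]=E_{el}[Q_h]+s .$$ $C_*>0$ is a fixed constant such that $|\Omega|\,\mathcal F_{\rm bulk}(A)\ge -C_*$ for every symmetric trace-free $A\in\mathbb R^{3\times3}$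 (so $\mathcal E_{1h}\ge -C_*$ on $\mathbf S_h^{(3)}$). Set $g(Q_h,s)=\exp\{s\}/\exp\{\mathcal E_{1h}[Q_h]\}$. Operator: $\mathcal D_h^cQ_h^{ij}=\sum_{k=1}^3\big(D_{jk}^cQ_h^{ik}+D_{ik}^cQ_h^{jk}\big)-\frac23\sum_{k,l=1}^3D_{lk}^cQ_h^{lk}\,\delta^{ij}$. First-order scheme. For $(P_h,\sigma)\in\mathbf S_h^{(3)}\times\mathbb R$ and step $\theta>0$, $(P_h^{+},\sigma^{+})=\mathrm{sESAV1}(P_h,\sigma,\theta)\in\mathbf S_h^{(3)}\times\mathbb R$ is defined by, for $i,j=1,2,3$ at all interior grid points, $$\frac{P_h^{+,ij}-P_h^{ij}}{\theta}=L_1\Delta_hP_h^{+,ij}+\frac{L_2+L_3}{2}\mathcal D_h^cP_h^{+,ij}+g(P_h,\sigma)\big(f(P_h^{ij})-\kappa(P_h^{+,ij}-P_h^{ij})\big),$$ $$\tilde\sigma^{+}=\sigma-g(P_h,\sigma)\sum_{i,j=1}^3\langle f(P_h^{ij}),P_h^{+,ij}-P_h^{ij}\rangle_h,\qquad \sigma^{+}=\max\{\tilde\sigma^{+},-C_*-E_{el}[P_h^{+}]\}.$$ Second-order scheme (sESAV2). Given $(Q_h^n,s^n)$, set $(Q_{*,h}^{n+1/2},s_*^{n+1/2})=\mathrm{sESAV1}(Q_h^n,s^n,\tau/2)$, $g_*=g(Q_{*,h}^{n+1/2},s_*^{n+1/2})$ and $Q_h^{n+1/2}=(Q_h^{n+1}+Q_h^n)/2$.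 Then $(Q_h^{n+1},s^{n+1})\in\mathbf S_h^{(3)}\times\mathbb R$ is defined by, for $i,j=1,2,3$ at all interior grid points, $$\frac{Q_h^{ij,n+1}-Q_h^{ij,n}}{\tau}=L_1\Delta_hQ_h^{ij,n+1/2}+\frac{L_2+L_3}{2}\mathcal D_h^cQ_h^{ij,n+1/2}+g_*\big(f(Q_{*,h}^{ij,n+1/2})-\kappa(Q_h^{ij,n+1/2}-Q_{*,h}^{ij,n+1/2})\big),$$ $$\tilde s^{n+1}=s^n-g_*\sum_{i,j=1}^3\langle f(Q_{*,h}^{ij,n+1/2}),Q_h^{ij,n+1}-Q_h^{ij,n}\rangle_h+\kappa g_*\sum_{i,j=1}^3\langle Q_h^{ij,n+1/2}-Q_{*,h}^{ij,n+1/2},Q_h^{ij,n+1}-Q_h^{ij,n}\rangle_h,$$ $$s^{n+1}=\max\{\tilde s^{n+1},-C_*-E_{el}[Q_h^{n+1}]\}.$$ *)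

(* Defs.v *)
From HB Require Import structures.
From mathcomp Require Import all_boot all_order all_algebra.
From mathcomp Require Import all_reals all_analysis.
Set Implicit Arguments.
Unset Strict Implicit.
Unset Printing Implicit Defensive.
Import Order.TTheory GRing.Theory Num.Theory.
Local Open Scope ring_scope.

(* The nodes are the (p, q, r) with 0 <= p, q, r <= M. *)
Definition node (M : nat) : finType := {ffun 'I_3 -> 'I_M.+1}.

Definition interior_node (M : nat) (x : node M) : bool :=
  [forall k, 0 < x k < M]%N.

Definition gridfun (R : realType) (M : nat) := {ffun node M -> R}.
Definition tensorfield (R : realType) (M : nat) := {ffun node M -> 'M[R]_3}.

Section GridSpaces.
Variables (R : realType) (M : nat).
Implicit Types (U V : gridfun R M) (P Q : tensorfield R M).

Definition in_E0 U : Prop := forall x, ~~ interior_node x -> U x = 0.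

Definition entry Q (i j : 'I_3) : gridfun R M := [ffun x => Q x i j].

Definition in_S Q : Prop :=
  [/\ forall i j, in_E0 (entry Q i j),
      forall i j, entry Q i j = entry Q j i
    & forall x, \tr (Q x) = 0].

Definition node_pos (x : node M) : 'rV[int]_3 := \row_k (x k)%:Z.

(* Extension by zero to all of Z^3. Only the layers of ghost nodes with an
   index -1 or M + 1 are ever reached by the difference operators below. *)
Definition ext U (z : 'rV[int]_3) : R :=
  if [pick x | node_pos x == z] is Some x then U x else 0.

End GridSpaces.

Section Differences.
Variables (R : realType) (h : R).
Implicit Types (u : 'rV[int]_3 -> R) (z : 'rV[int]_3) (k : 'I_3).

Definition unit_step k : 'rV[int]_3 := delta_mx 0 k.

(* The value at the edge from z to z + e_k is stored at z. *)
Definition Dp k u z : R := (u (z + unit_step k) - u z) / h.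

Definition Dc k u z : R := (u (z + unit_step k) - u (z - unit_step k)) / (2 * h).

Definition Dc2 k l u : 'rV[int]_3 -> R := Dc k (Dc l u).

Definition Lap u z : R :=
  \sum_k (u (z + unit_step k) - 2 * u z + u (z - unit_step k)) / h ^+ 2.

End Differences.

Section DiscreteNorms.
Variables (R : realType) (M : nat) (h : R).
Implicit Types (U V : gridfun R M) (P Q : tensorfield R M).

Definition inner U V : R := h ^+ 3 * \sum_x U x * V x.
Definition norm2 U : R := inner U U.

Definition tinner P Q : R := \sum_i \sum_j inner (entry P i j) (entry Q i j).

(* The edges of the grid in direction k start at the nodes x with x k < M. *)
Definition edge_norm2 k U : R :=
  h ^+ 3 * \sum_(x : node M | (x k < M)%N) Dp h k (ext U) (node_pos x) ^+ 2.

Definition grad_norm2 U : R := \sum_k edge_norm2 k U.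
Definition tgrad_norm2 Q : R := \sum_i \sum_j grad_norm2 (entry Q i j).

Definition div_row Q (i : 'I_3) : gridfun R M :=
  [ffun x => \sum_k Dc h k (ext (entry Q i k)) (node_pos x)].

Definition Dop Q (i j : 'I_3) (z : 'rV[int]_3) : R :=
  \sum_k (Dc2 h j k (ext (entry Q i k)) z + Dc2 h i k (ext (entry Q j k)) z)
  - 2 / 3 * (\sum_k \sum_l Dc2 h l k (ext (entry Q l k)) z) *+ (i == j).

End DiscreteNorms.

Section Bulk.
Variables (R : realType) (a b c : R).
Implicit Type A : 'M[R]_3.

Definition Fbulk A : R :=
  a / 2 * \tr (A *m A) - b / 3 * \tr (A *m A *m A)
  + c / 4 * (\tr (A *m A)) ^+ 2.

Definition fnl A : 'M[R]_3 :=
  - a *: A + b *: (A *m A - (1 / 3 * \tr (A *m A))%:M)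
  - (c * \tr (A *m A)) *: A.

End Bulk.

Section Scheme.
Variables (R : realType) (M : nat) (a b c L1 L2 L3 kappa Cs h : R).
Implicit Types (P Q : tensorfield R M) (s theta tau : R).

Definition E1h Q : R :=
  inner h [ffun x => Fbulk a b c (Q x)] [ffun => 1].

Definition Eel Q : R :=
  L1 / 2 * tgrad_norm2 h Q
  + (L2 + L3) / 2 * \sum_i norm2 h (div_row h Q i).

Definition Eh Q s : R := Eel Q + s.

Definition gfac Q s : R := expR s / expR (E1h Q).

Definition fnl_field Q : tensorfield R M := [ffun x => fnl a b c (Q x)].

Definition elastic_op Q (i j : 'I_3) (x : node M) : R :=
  L1 * Lap h (ext (entry Q i j)) (node_pos x)
  + (L2 + L3) / 2 * Dop h Q i j (node_pos x).

(* The steps are implicit, so they are stated as relations between the old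
   and the new state. *)
Definition sESAV1 P s theta P' s' : Prop :=
  let g := gfac P s in
  let s_tilde := s - g * tinner h (fnl_field P) (P' - P) in
  [/\ in_S P',
      forall i j x, interior_node x ->
        (P' x i j - P x i j) / theta
        = elastic_op P' i j x
          + g * (fnl_field P x i j - kappa * (P' x i j - P x i j))
    & s' = Num.max s_tilde (- Cs - Eel P')].

Definition sESAV2_from tau Q s Qst sst Q' s' : Prop :=
  let g := gfac Qst sst in
  let Qh : tensorfield R M := [ffun x => 2^-1 *: (Q' x + Q x)] in
  let s_tilde := s - g * tinner h (fnl_field Qst) (Q' - Q)
                 + kappa * g * tinner h (Qh - Qst) (Q' - Q) in
  [/\ in_S Q',
      forall i j x, interior_node x ->
        (Q' x i j - Q x i j) / tau
        = elastic_op Qh i j x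
          + g * (fnl_field Qst x i j - kappa * (Qh x i j - Qst x i j))
    & s' = Num.max s_tilde (- Cs - Eel Q')].

Definition sESAV2 tau Q s Q' s' : Prop :=
  exists Qst : tensorfield R M, exists sst : R,
    sESAV1 Q s (tau / 2) Qst sst /\ sESAV2_from tau Q s Qst sst Q' s'.

End Scheme.

(* Main.v *)
Require Import Defs.
From mathcomp Require Import all_boot all_order all_algebra.
From mathcomp Require Import all_reals all_analysis.
From mathcomp Require Import ring lra zify.

(** The scheme is a midpoint rule for a gradient flow, so it is tested with the
    increment D = Q' - Q. The elastic energy is quadratic, and by polarization
    its change over the step is its bilinear form at the midpoint paired with D
    ([Eel_sub]); by summation by parts this is minus the elastic operator at the
    midpoint paired with D ([tinner_elastic_field]). The increment of the
    unclipped auxiliary variable is minus the remaining terms of the tested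
    scheme. All these terms cancel, and the unclipped energy changes by exactly
    - |D|^2 / tau <= 0 ([step_dissipation]).

    Clipping replaces the new energy by its maximum with - Cs. This is harmless
    as soon as the old energy is at least - Cs ([sESAV2_dissipation]). After one
    step the clipping itself ensures this bound ([sESAV2_lower]); initially the
    energy is the elastic energy, which is nonnegative, plus the bulk energy,
    which is at least - Cs by the pointwise bound on the bulk density
    ([E1h_ge]).

    Summation by parts rests on [sum_translate]: for functions that vanish
    on the first face and outside the grid, a translation by one step does not
    change the sum over the nodes. *)

Set Implicit Arguments.
Unset Strict Implicit.
Unset Printing Implicit Defensive.
Import Order.TTheory GRing.Theory Num.Theory.
Local Open Scope ring_scope.

(** * Zero extension to the integer lattice *)

Section Extension.
Variables (R : realType) (M : nat).
Implicit Types (U V : gridfun R M) (x : node M) (z : 'rV[int]_3) (k : 'I_3).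

Lemma node_pos_inj : injective (@node_pos M).
Proof.
move=> x y exy; apply/ffunP => k; apply/val_inj.
by have := congr1 (fun z : 'rV[int]_3 => z 0 k) exy; rewrite !mxE => -[].
Qed.

Lemma ext_node_pos U x : ext U (node_pos x) = U x.
Proof.
rewrite /ext; case: pickP => [y /eqP/node_pos_inj -> //|/(_ x)].
by rewrite eqxx.
Qed.

Lemma extB U V z : ext (U - V) z = ext U z - ext V z.
Proof. by rewrite /ext; case: pickP => [x _|_]; rewrite ?ffunE ?subr0. Qed.

Lemma extD U V z : ext (U + V) z = ext U z + ext V z.
Proof. by rewrite /ext; case: pickP => [x _|_]; rewrite ?ffunE ?addr0. Qed.

Lemma extZ (t : R) U z : ext [ffun x => t * U x] z = t * ext U z.
Proof. by rewrite /ext; case: pickP => [x _|_]; rewrite ?ffunE ?mulr0. Qed.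

Lemma ext_eq0 U z k : in_E0 U -> ~~ (0 < z 0 k < M%:Z) -> ext U z = 0.
Proof.
move=> U0 zk; rewrite /ext; case: pickP => [x /eqP xz|//]; apply: U0.
apply: contra zk => /forallP/(_ k); rewrite -xz mxE; lia.
Qed.

End Extension.

(** * Summation by parts *)

Section SummationByParts.
Variables (R : realType) (M : nat).
Implicit Types (u v F : 'rV[int]_3 -> R) (V : gridfun R M).
Implicit Types (x : node M) (z : 'rV[int]_3) (k : 'I_3).

Definition cyclic_shift k x : node M :=
  [ffun j => if j == k then ordS (x j) else x j].

Lemma cyclic_shift_bij k : bijective (cyclic_shift k).
Proof.
exists (fun x => [ffun j => if j == k then ord_pred (x j) else x j]) => x;
  by apply/ffunP => j; rewrite !ffunE; case: eqP => // _; rewrite (ordSK, ord_predK).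
Qed.

Lemma unit_stepE k j : unit_step k 0 j = (j == k)%:R.
Proof. by rewrite mxE. Qed.

(** Translating the lattice by one step agrees with the cyclic shift of the
    nodes, except on the last face, where the translated node has left the grid
    and the cyclic one has come back on the first face: [F] vanishes at both. *)
Lemma sum_translate k F :
  (forall z, ~~ (0 < z 0 k <= M%:Z) -> F z = 0) ->
  \sum_(x : node M) F (node_pos x + unit_step k) = \sum_(x : node M) F (node_pos x).
Proof.
move=> F0; rewrite [RHS](reindex (cyclic_shift k)) /=; last first.
  exact/onW_bij/cyclic_shift_bij.
apply: eq_bigr => x _; have [xM|xM] := ltnP (x k) M.
  congr F; apply/rowP => j; rewrite !mxE ffunE eqxx /=.
  case: eqP => [->|_]; last by rewrite addr0.
  by rewrite /= modn_small ?ltnS // addrC -intS.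
have {}xM : x k = M :> nat by have := ltn_ord (x k); lia.
rewrite !F0 //; last by rewrite !mxE ?eqxx xM /=; lia.
by rewrite mxE ffunE eqxx /= xM modnn.
Qed.

Lemma sum_mul_fwd k u V : in_E0 V ->
  \sum_x u (node_pos x + unit_step k) * V x
  = \sum_(x : node M) u (node_pos x) * ext V (node_pos x - unit_step k).
Proof.
move=> V0; rewrite -(@sum_translate k (fun z => u z * ext V (z - unit_step k))).
  by apply: eq_bigr => x _; rewrite addrK ext_node_pos.
move=> z zk; rewrite (@ext_eq0 _ _ _ _ k V0) ?mulr0 //.
by move: zk; rewrite !mxE !eqxx /=; lia.
Qed.

Lemma sum_mul_bwd k u V : in_E0 V ->
  \sum_x u (node_pos x - unit_step k) * V x
  = \sum_(x : node M) u (node_pos x) * ext V (node_pos x + unit_step k).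
Proof.
move=> V0.
transitivity (\sum_(x : node M) u (node_pos x - unit_step k) * ext V (node_pos x)).
  by apply: eq_bigr => x _; rewrite ext_node_pos.
rewrite -(@sum_translate k (fun z => u (z - unit_step k) * ext V z)).
  by apply: eq_bigr => x _; rewrite addrK.
move=> z zk; rewrite (@ext_eq0 _ _ _ _ k V0) ?mulr0 //.
by move: zk; lia.
Qed.

(** The centered difference is skew-adjoint. Only [V] has to vanish on the
    boundary: in each of the two translated products it is [V] that confines the
    sum to the grid. In particular [u] may itself be a centered difference, which
    does not vanish there. *)
Lemma sum_Dc (h : R) k u V : in_E0 V ->
  \sum_x Dc h k u (node_pos x) * V x
  = - \sum_(x : node M) u (node_pos x) * Dc h k (ext V) (node_pos x).
Proof.
move=> V0; rewrite /Dc.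
transitivity ((\sum_x u (node_pos x + unit_step k) * V x
  - \sum_x u (node_pos x - unit_step k) * V x) / (2 * h)).
  by rewrite -sumrB mulr_suml; apply: eq_bigr => x _; ring.
rewrite sum_mul_fwd // sum_mul_bwd // -sumrB mulr_suml -sumrN.
by apply: eq_bigr => x _; ring.
Qed.

(** Discrete Green formula. The edge leaving the last face carries a zero
    difference of [V], so the edge sum may be taken over all nodes. *)
Lemma sum_Lap (h : R) u V : in_E0 V ->
  \sum_x Lap h u (node_pos x) * V x
  = - \sum_k \sum_(x : node M | (x k < M)%N)
        Dp h k u (node_pos x) * Dp h k (ext V) (node_pos x).
Proof.
move=> V0; rewrite /Lap.
under eq_bigr do rewrite mulr_suml.
rewrite exchange_big /= -sumrN; apply: eq_bigr => k _.
pose d z := u (z + unit_step k) - u z.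
have -> : \sum_(x : node M | (x k < M)%N)
      Dp h k u (node_pos x) * Dp h k (ext V) (node_pos x)
    = \sum_(x : node M)
      Dp h k u (node_pos x) * Dp h k (ext V) (node_pos x).
  rewrite big_mkcond /=; apply: eq_bigr => x _; case: ltnP => // xM.
  by rewrite /Dp !(@ext_eq0 _ _ _ _ k V0) ?subrr ?mul0r ?mulr0 //
    !mxE ?eqxx /=; move: xM; lia.
transitivity ((\sum_(x : node M) d (node_pos x) * V x
  - \sum_(x : node M) d (node_pos x - unit_step k) * V x) / h ^+ 2).
  by rewrite -sumrB mulr_suml; apply: eq_bigr => x _; rewrite /d subrK; ring.
rewrite sum_mul_bwd // -sumrB mulr_suml -sumrN.
by apply: eq_bigr => x _; rewrite /Dp /d ext_node_pos -exprVn; ring.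
Qed.

End SummationByParts.

(** * The elastic energy as a quadratic form *)

Section Elastic.
Variables (R : realType) (M : nat) (L1 L2 L3 h : R).
Implicit Types (U V : gridfun R M) (P Q D : tensorfield R M).

Definition edge_inner k U V : R :=
  h ^+ 3 * \sum_(x : node M | (x k < M)%N)
    Dp h k (ext U) (node_pos x) * Dp h k (ext V) (node_pos x).

Definition elastic_form P Q : R :=
  L1 * \sum_i \sum_j \sum_k edge_inner k (entry P i j) (entry Q i j)
  + (L2 + L3) * \sum_i inner h (div_row h P i) (div_row h Q i).

Definition elastic_field P : tensorfield R M :=
  [ffun x => \matrix_(i, j) elastic_op L1 L2 L3 h P i j x].

Definition midpoint P Q : tensorfield R M := [ffun x => 2^-1 *: (P x + Q x)].

Lemma ext_entryB P Q i j z :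
  ext (entry (P - Q) i j) z = ext (entry P i j) z - ext (entry Q i j) z.
Proof. by rewrite -extB; congr ext; apply/ffunP => x; rewrite !ffunE !mxE. Qed.

Lemma ext_entry_midpoint P Q i j z :
  ext (entry (midpoint P Q) i j) z
  = 2^-1 * (ext (entry P i j) z + ext (entry Q i j) z).
Proof.
by rewrite -extD -extZ; congr ext; apply/ffunP => x; rewrite !ffunE !mxE.
Qed.

Lemma in_SB P Q : in_S P -> in_S Q -> in_S (P - Q).
Proof.
move=> [P0 Ps Pt] [Q0 Qs Qt]; split=> [i j x xb|i j|x].
- have := P0 i j x xb; have := Q0 i j x xb.
  by rewrite !ffunE !mxE => -> ->; rewrite subrr.
- apply/ffunP => x; have /ffunP/(_ x) := Ps i j; have /ffunP/(_ x) := Qs i j.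
  by rewrite !ffunE !mxE => -> ->.
- by rewrite !ffunE raddfB /= Pt Qt subrr.
Qed.

Lemma tinnerE P Q : tinner h P Q
  = h ^+ 3 * \sum_(w : 'I_3 * 'I_3) \sum_x P x w.1 w.2 * Q x w.1 w.2.
Proof.
rewrite /tinner pair_bigA /= mulr_sumr; apply: eq_bigr => w _.
by congr (_ * _); apply: eq_bigr => x _; rewrite !ffunE.
Qed.

Lemma grad_polarization P Q :
  tgrad_norm2 h P - tgrad_norm2 h Q
  = 2 * \sum_i \sum_j \sum_k
      edge_inner k (entry (midpoint P Q) i j) (entry (P - Q) i j).
Proof.
rewrite -sumrB mulr_sumr; apply: eq_bigr => i _.
rewrite -sumrB mulr_sumr; apply: eq_bigr => j _.
rewrite -sumrB mulr_sumr; apply: eq_bigr => k _.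
rewrite /edge_norm2 /edge_inner -mulrBr mulrCA; congr (_ * _).
rewrite -sumrB mulr_sumr; apply: eq_bigr => x _.
rewrite /Dp !ext_entryB !ext_entry_midpoint; move: h^-1 => r.
by field.
Qed.

Lemma div_polarization P Q i :
  norm2 h (div_row h P i) - norm2 h (div_row h Q i)
  = 2 * inner h (div_row h (midpoint P Q) i) (div_row h (P - Q) i).
Proof.
rewrite /norm2 /inner -mulrBr mulrCA; congr (_ * _).
rewrite -sumrB mulr_sumr; apply: eq_bigr => x _; rewrite !ffunE.
have -> : \sum_k Dc h k (ext (entry (P - Q) i k)) (node_pos x)
    = \sum_k Dc h k (ext (entry P i k)) (node_pos x)
      - \sum_k Dc h k (ext (entry Q i k)) (node_pos x).
  by rewrite -sumrB; apply: eq_bigr => k _; rewrite /Dc !ext_entryB; ring.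
have -> : \sum_k Dc h k (ext (entry (midpoint P Q) i k)) (node_pos x)
    = 2^-1 * (\sum_k Dc h k (ext (entry P i k)) (node_pos x)
      + \sum_k Dc h k (ext (entry Q i k)) (node_pos x)).
  rewrite -big_split mulr_sumr; apply: eq_bigr => k _.
  by rewrite /Dc !ext_entry_midpoint /=; ring.
by field.
Qed.

(** A quadratic form [q] with symmetric bilinear form [B] satisfies
    q(P) - q(Q) = 2 B((P + Q) / 2, P - Q): the midpoint value is the exact
    difference quotient of the energy, with no second-order remainder. *)
Lemma Eel_sub P Q :
  Eel L1 L2 L3 h P - Eel L1 L2 L3 h Q = elastic_form (midpoint P Q) (P - Q).
Proof.
have := grad_polarization P Q.
have : \sum_i norm2 h (div_row h P i) - \sum_i norm2 h (div_row h Q i)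
  = 2 * \sum_i inner h (div_row h (midpoint P Q) i) (div_row h (P - Q) i).
  by rewrite -sumrB mulr_sumr; apply: eq_bigr => i _; apply: div_polarization.
rewrite /Eel /elastic_form.
set d1 := \sum_i _; set d2 := \sum_i _; set d := \sum_i _.
set t1 := tgrad_norm2 _ P; set t2 := tgrad_norm2 _ Q; set t := \sum_i _.
move=> /eqP; rewrite subr_eq => /eqP -> /eqP; rewrite subr_eq => /eqP ->.
by field.
Qed.

Lemma Eel_ge0 Q : 0 <= L1 -> 0 <= L2 + L3 -> 0 < h -> 0 <= Eel L1 L2 L3 h Q.
Proof.
move=> L1_ge0 L23_ge0 h_gt0; have h3 : 0 <= h ^+ 3 by rewrite exprn_ge0 ?ltW.
rewrite addr_ge0 ?mulr_ge0 ?divr_ge0 //.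
- apply: sumr_ge0 => i _; apply: sumr_ge0 => j _; apply: sumr_ge0 => k _.
  by rewrite mulr_ge0 ?sumr_ge0 // => x _; apply: sqr_ge0.
- apply: sumr_ge0 => i _; rewrite mulr_ge0 ?sumr_ge0 // => x _.
  by rewrite -expr2 sqr_ge0.
Qed.

(** Against a symmetric trace-free test field [D], the two halves of the
    symmetrized operator contribute equally and its trace correction, a multiple
    of the identity, contributes nothing. What remains is the weak form of twice
    the gradient of the row-wise divergence. *)
Lemma sum_Dop P D : in_S D ->
  \sum_i \sum_j \sum_x Dop h P i j (node_pos x) * D x i j
  = - 2 * \sum_i \sum_x div_row h P i x * div_row h D i x.
Proof.
move=> [D0 Ds Dt].
have Dsx i j x : D x i j = D x j i.
  by have /ffunP/(_ x) := Ds i j; rewrite !ffunE.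
pose half i j (x : node M) := \sum_k Dc2 h j k (ext (entry P i k)) (node_pos x).
pose tr0 (x : node M) := 2 / 3 *
  (\sum_k \sum_l Dc2 h l k (ext (entry P l k)) (node_pos x)).
have half_div i : \sum_j \sum_x half i j x * D x i j
    = - \sum_x div_row h P i x * div_row h D i x.
  transitivity (- \sum_j \sum_(x : node M)
      (\sum_k Dc h k (ext (entry P i k)) (node_pos x)) * Dc h j (ext (entry D i j)) (node_pos x)).
    rewrite -sumrN; apply: eq_bigr => j _.
    under eq_bigr do rewrite /half mulr_suml.
    rewrite exchange_big /=.
    under [in RHS]eq_bigr do rewrite mulr_suml.
    rewrite [in RHS]exchange_big /= -sumrN; apply: eq_bigr => k _.
    rewrite -sum_Dc //.
    by apply: eq_bigr => x _; rewrite ffunE.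
  congr (- _); rewrite exchange_big /=; apply: eq_bigr => x _.
  by rewrite !ffunE mulr_sumr.
transitivity (\sum_i \sum_j \sum_x half i j x * D x i j
  + \sum_i \sum_j \sum_x half j i x * D x i j
  - \sum_i \sum_j \sum_x (tr0 x * D x i j) *+ (i == j)).
  rewrite -big_split -sumrB; apply: eq_bigr => i _.
  rewrite -big_split -sumrB; apply: eq_bigr => j _.
  rewrite -big_split -sumrB; apply: eq_bigr => x _.
  rewrite /Dop big_split /= -/(half i j x) -/(half j i x).
  by case: eqP => _; rewrite /tr0 ?mulr0n ?mulr1n; ring.
have -> : \sum_i \sum_j \sum_x (tr0 x * D x i j) *+ (i == j) = 0.
  transitivity (\sum_i \sum_x tr0 x * D x i i).
    apply: eq_bigr => i _; rewrite (bigD1 i) //= eqxx [X in _ + X]big1 ?addr0 //.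
    by move=> j /negPf; rewrite eq_sym => ->; rewrite big1.
  rewrite exchange_big big1 //= => x _.
  by rewrite -mulr_sumr -/(\tr (D x)) Dt mulr0.
have -> : \sum_i \sum_j \sum_x half j i x * D x i j
    = \sum_i \sum_j \sum_x half i j x * D x i j.
  rewrite exchange_big; apply: eq_bigr => i _; apply: eq_bigr => j _.
  by apply: eq_bigr => x _; rewrite Dsx.
under eq_bigr do rewrite half_div.
by rewrite sumrN; ring.
Qed.

(** The elastic operator, restricted to symmetric trace-free variations, is minus
    the gradient of the elastic energy, in weak form. *)
Lemma tinner_elastic_field P D : in_S D ->
  tinner h (elastic_field P) D = - elastic_form P D.
Proof.
move=> DS; have [D0 _ _] := DS; rewrite tinnerE -(pair_bigA _ (fun i j =>
  \sum_x elastic_field P x i j * D x i j)) /=.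
transitivity (h ^+ 3 * (L1 * (\sum_i \sum_j \sum_x
    Lap h (ext (entry P i j)) (node_pos x) * entry D i j x)
  + (L2 + L3) / 2 * \sum_i \sum_j \sum_x Dop h P i j (node_pos x) * D x i j)).
  congr (_ * _); rewrite !mulr_sumr -big_split; apply: eq_bigr => i _ /=.
  rewrite !mulr_sumr -big_split; apply: eq_bigr => j _ /=.
  rewrite !mulr_sumr -big_split; apply: eq_bigr => x _ /=.
  by rewrite !ffunE mxE /elastic_op; ring.
rewrite sum_Dop //.
under eq_bigr do under eq_bigr do rewrite sum_Lap //.
rewrite /elastic_form /edge_inner /inner.
under [in RHS]eq_bigr do under eq_bigr do rewrite -mulr_sumr.
under [in RHS]eq_bigr do rewrite -mulr_sumr.
under eq_bigr do rewrite sumrN.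
by rewrite sumrN -!mulr_sumr; field.
Qed.

End Elastic.

(** * Energy balance of one step *)

Section Step.
Variables (R : realType) (M : nat) (a b c L1 L2 L3 kappa Cs h : R).
Implicit Types (P Q D : tensorfield R M).

Lemma tinner_ge0 D : 0 <= h -> 0 <= tinner h D D.
Proof.
move=> h_ge0; rewrite tinnerE mulr_ge0 ?exprn_ge0 //.
by apply: sumr_ge0 => w _; apply: sumr_ge0 => x _; rewrite -expr2 sqr_ge0.
Qed.

(** Testing the scheme with the increment [Q' - Q]. The left-hand side is the
    change of the total energy under the unclipped update: the nonlinear and
    stabilizing terms of the tested scheme are the ones that this update adds to
    the auxiliary variable with the opposite sign, whatever the factor [g]. *)
Lemma step_dissipation tau g Q Qst Q' :
  in_S Q -> in_S Q' ->
  (forall i j x, interior_node x ->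
     (Q' x i j - Q x i j) / tau
     = elastic_op L1 L2 L3 h (midpoint Q' Q) i j x
       + g * (fnl_field a b c Qst x i j
              - kappa * (midpoint Q' Q x i j - Qst x i j))) ->
  Eel L1 L2 L3 h Q' - Eel L1 L2 L3 h Q
  - g * tinner h (fnl_field a b c Qst) (Q' - Q)
  + kappa * g * tinner h (midpoint Q' Q - Qst) (Q' - Q)
  = - (tinner h (Q' - Q) (Q' - Q) / tau).
Proof.
move=> QS Q'S eqn; have DS := in_SB Q'S QS.
rewrite Eel_sub -[elastic_form _ _ _ _ _ _]opprK -tinner_elastic_field //.
suff -> : tinner h (Q' - Q) (Q' - Q) / tau
    = tinner h (elastic_field L1 L2 L3 h (midpoint Q' Q)) (Q' - Q)
      + g * tinner h (fnl_field a b c Qst) (Q' - Q)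
      - kappa * g * tinner h (midpoint Q' Q - Qst) (Q' - Q) by ring.
rewrite !tinnerE !(mulrCA _ (h ^+ 3)) -mulrA -!mulrDr -mulrBr; congr (_ * _).
rewrite mulr_suml !mulr_sumr -big_split -sumrB; apply: eq_bigr => -[i j] _ /=.
rewrite mulr_suml !mulr_sumr -big_split -sumrB; apply: eq_bigr => x _ /=.
(* The scheme holds at interior nodes only; elsewhere the increment is zero. *)
have [xi|xb] := boolP (interior_node x); last first.
  have [/(_ i j x xb)] := DS; rewrite ffunE => -> _ _.
  by rewrite !mulr0 mul0r addr0 subr0.
rewrite mulrAC; have -> : (Q' - Q) x i j / tau = (Q' x i j - Q x i j) / tau.
  by rewrite !ffunE !mxE.
rewrite eqn // [elastic_field _ _ _ _ _ x]ffunE mxE.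
have -> : (midpoint Q' Q - Qst) x i j = midpoint Q' Q x i j - Qst x i j.
  by rewrite !ffunE !mxE.
by ring.
Qed.

(** Clipping can only raise the total energy to the level [- Cs], and the
    energy of the previous state is at least that. *)
Lemma sESAV2_dissipation tau Q s Q' s' : 0 <= h -> 0 < tau -> in_S Q ->
  - Cs <= Eh L1 L2 L3 h Q s ->
  sESAV2 a b c L1 L2 L3 kappa Cs h tau Q s Q' s' ->
  Eh L1 L2 L3 h Q' s' <= Eh L1 L2 L3 h Q s.
Proof.
move=> h_ge0 tau_gt0 QS lower [Qst [sst [_ [Q'S eqn ->]]]].
have diss := step_dissipation QS Q'S eqn.
have := divr_ge0 (tinner_ge0 (Q' - Q) h_ge0) (ltW tau_gt0).
rewrite {1}/Eh -lerBrDl ge_max => D_ge0.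
apply/andP; split; last by rewrite lerB // lower.
rewrite -/(midpoint Q' Q) /Eh.
move: diss D_ge0.
set X := tinner _ _ _ / tau.
lra.
Qed.

(** The clipping is what propagates the lower bound on the total energy. *)
Lemma sESAV2_lower tau Q s Q' s' :
  sESAV2 a b c L1 L2 L3 kappa Cs h tau Q s Q' s' ->
  in_S Q' /\ - Cs <= Eh L1 L2 L3 h Q' s'.
Proof.
move=> [Qst [sst [_ [Q'S _ ->]]]]; split=> //.
by rewrite /Eh -lerBlDl le_max lexx orbT.
Qed.

End Step.

(** * Lower bound for the bulk energy *)

Section Bulk.
Variables (R : realType) (M : nat) (a b c : R).

Lemma card_interior_node : (#|@interior_node M| <= M ^ 3)%N.
Proof.
(* An interior node avoids the index 0, which leaves M values per direction. *)
have -> : (M ^ 3 = #|@ffun_on_mem 'I_3 'I_M.+1 (mem (predC1 ord0))|)%N.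
  by rewrite card_ffun_on cardC1 !card_ord.
apply/subset_leq_card/subsetP => x /forallP xi; apply/ffun_onP => k.
by have := xi k; rewrite inE -val_eqE /=; lia.
Qed.

Lemma Fbulk0 : Fbulk a b c (0 : 'M[R]_3) = 0.
Proof. by rewrite /Fbulk !mul0mx mxtrace0; ring. Qed.

(** The bulk energy density vanishes on the boundary, and the grid has fewer
    interior nodes than cells; so the pointwise bound integrates over the domain
    without loss. *)
Lemma E1h_ge (Ld Cs : R) (Q : tensorfield R M) :
  0 < Ld -> (0 < M)%N -> 0 <= Cs ->
  (forall A : 'M[R]_3, A^T = A -> \tr A = 0 ->
     - Cs <= Ld ^+ 3 * Fbulk a b c A) ->
  in_S Q -> - Cs <= E1h a b c (Ld / M%:R) Q.
Proof.
move=> Ld_gt0 M_gt0 Cs_ge0 bulk [Q0 Qs Qt].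
have M3_gt0 : 0 < M%:R ^+ 3 :> R by rewrite exprn_gt0 ?ltr0n.
have -> : E1h a b c (Ld / M%:R) Q
    = (\sum_(x | interior_node x) Ld ^+ 3 * Fbulk a b c (Q x)) / M%:R ^+ 3.
  rewrite /E1h /inner expr_div_n mulrAC mulr_sumr; congr (_ / _).
  rewrite [RHS]big_mkcond; apply: eq_bigr => x _; rewrite !ffunE mulr1.
  case: ifPn => // xb; suff -> : Q x = 0 by rewrite Fbulk0 mulr0.
  by apply/matrixP => i j; have := Q0 i j x xb; rewrite ffunE mxE.
rewrite ler_pdivlMr // mulNr.
have le_sum : \sum_(x | @interior_node M x) - Cs
    <= \sum_(x | interior_node x) Ld ^+ 3 * Fbulk a b c (Q x).
  apply: ler_sum => x _; apply: bulk => //.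
  by apply/matrixP => i j; have /ffunP/(_ x) := Qs j i; rewrite !ffunE mxE.
apply: le_trans le_sum; rewrite sumr_const mulNrn lerN2 -[Cs *+ _]mulr_natr.
by rewrite ler_wpM2l // -natrX ler_nat card_interior_node.
Qed.

End Bulk.

Theorem theorem3p2 (R : realType) (a b c L1 L2 L3 Ld Cs kappa tau : R)
    (M : nat) (Q : nat -> tensorfield R M) (s : nat -> R) :
  let h := Ld / M%:R in
  0 <= b -> 0 < c -> 0 < L1 -> 0 < L2 -> 0 < L3 ->
  0 < Ld -> (0 < M)%N ->
  0 < Cs ->
  (forall A : 'M[R]_3, A^T = A -> \tr A = 0 -> - Cs <= Ld ^+ 3 * Fbulk a b c A) ->
  0 <= kappa -> 0 < tau ->
  in_S (Q 0%N) ->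
  s 0%N = E1h a b c h (Q 0%N) ->
  (forall n : nat,
     sESAV2 a b c L1 L2 L3 kappa Cs h tau (Q n) (s n) (Q n.+1) (s n.+1)) ->
  forall n : nat,
    Eh L1 L2 L3 h (Q n.+1) (s n.+1) <= Eh L1 L2 L3 h (Q n) (s n).
Proof.
move=> h _ _ L1_gt0 L2_gt0 L3_gt0 Ld_gt0 M_gt0 Cs_gt0 bulk _ tau_gt0 Q0S s0 scheme.
have h_gt0 : 0 < h by rewrite divr_gt0 ?ltr0n.
have state n : in_S (Q n) /\ - Cs <= Eh L1 L2 L3 h (Q n) (s n).
  case: n => [|n]; last exact: sESAV2_lower (scheme n).
  split=> //; rewrite /Eh s0.
  by rewrite ler_wpDl ?Eel_ge0 ?E1h_ge ?addr_ge0 ?ltW.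
move=> n; have [QS lower] := state n.
exact: sESAV2_dissipation (ltW h_gt0) tau_gt0 QS lower (scheme n).
Qed.
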